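(* Let $(L,* )$ be an LD-system. An oracle that solves the generalized $n$-modsimItLDP for $S_A$ and the $*$-MSP for $S_A$ is sufficient to break key establishment Protocol 1.
   Context: An LD-system is a set $L$ with a binary operation $*$ such that $x*(y*z)=(x*y)*(x*z)$ for all $x,y,z\in L$. For a planar rooted binary tree $T$ with $k$ leaves, $T_*(y_1,\ldots,y_k)$ is the iterated product obtained by labelling the leaves from left to right by $y_1,\ldots,y_k\in L$ and evaluating internal vertices with $*$; $\langle y_1,\ldots,y_k\rangle_*$ is the submagma of all such products with leaves in $\{y_1,\ldots,y_k\}$. For $x=(x_1,\ldots,x_k)\in L^k$ put $\phi_x(y)=x_k*(x_{k-1}*\cdots*(x_2*(x_1*y))\cdots)$. Protocol 1: public elements $s_1,\ldots,s_m,t_1,\ldots,t_n\in L$ are given, with $S_A=\langle s_1,\ldots,s_m\rangle_*$, $S_B=\langle t_1,\ldots,t_n\rangle_*$. Alice's secret key is $(a_0,a)\in S_A\times L^{k_A}$ and Bob's secret key is $b\in S_B^{k_B}$ (for some secret $k_A,k_B\ge 1$). Put $\alpha=\phi_a$, $\beta=\phi_b$. Alice publishes $t_i'=\alpha(t_i)$ ($1\le i\le n$) and $p_0=\alpha(a_0)$; Bob publishes $s_j'=\beta(s_j)$ ($1\le j\le m$). The shared key is $K=\alpha(\beta(a_0))$. Breaking the protocol means finding $K$ from the public data $s_j,s_j',t_i,t_i',p_0$ (the attacker can evaluate $*$). Generalized $n$-modsimItLDP for $S_A$ (modified $n$-simultaneous iterated LD-problem): given $p_0\in L$ and pairs $(t_1,t_1'),\ldots,(t_n,t_n')\in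 L^2$ for which there are unknown $k_A$, $a\in L^{k_A}$ and $a_0\in S_A$ with $t_i'=\phi_a(t_i)$ for all $i\le n$ and $p_0=\phi_a(a_0)$, find $k_A'\in\mathbb{N}$, $a'\in L^{k_A'}$ and $a_0'\in S_A$ such that $\phi_{a'}(a_0')=p_0$ and $\phi_{a'}(t_i)=t_i'$ for all $i\le n$. $*$-MSP ($*$-submagma Membership Search Problem) for $S_A$: given $s_1,\ldots,s_m$ and an element $c\in S_A=\langle s_1,\ldots,s_m\rangle_*$, find a tree $T$ and $r_1,\ldots,r_l\in\{s_1,\ldots,s_m\}$ with $c=T_*(r_1,\ldots,r_l)$. *)

(* Defs.v *)
From mathcomp Require Import all_boot boolp.

Set Implicit Arguments.
Unset Strict Implicit.
Unset Printing Implicit Defensive.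

Inductive tree : Type := Leaf | Node of tree & tree.

Fixpoint leaves (T : tree) : nat :=
  if T is Node T1 T2 then leaves T1 + leaves T2 else 1.

(* T_*(y_1, ..., y_k), where k is the number of leaves of T. *)
Fixpoint tree_eval (L : Type) (op : L -> L -> L) (T : tree) :
    ('I_(leaves T) -> L) -> L :=
  match T return ('I_(leaves T) -> L) -> L with
  | Leaf => fun y => y ord0
  | Node T1 T2 => fun y =>
      op (tree_eval op (fun i : 'I_(leaves T1) => y (lshift (leaves T2) i)))
         (tree_eval op (fun i : 'I_(leaves T2) => y (rshift (leaves T1) i)))
  end.
Arguments tree_eval {L} op T y.

Definition LD_system (L : Type) (op : L -> L -> L) : Prop :=
  forall x y z : L, op x (op y z) = op (op x y) (op x z).

(* [presents op s c T r] says c = T_*(r_1, ..., r_l) with all r_i among the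
   entries of s. *)
Definition presents (L : Type) (op : L -> L -> L) (m : nat) (s : m.-tuple L)
    (c : L) (T : tree) (r : (leaves T).-tuple L) : Prop :=
  (forall i : 'I_(leaves T), exists j : 'I_m, tnth r i = tnth s j)
  /\ c = tree_eval op T (tnth r).

Definition in_submagma (L : Type) (op : L -> L -> L) (m : nat)
    (s : m.-tuple L) (c : L) : Prop :=
  exists (T : tree) (r : (leaves T).-tuple L), presents op s c r.

(* phi_x(y) = x_k * (... (x_2 * (x_1 * y))); the value at the empty sequence is
   the identity. *)
Definition phi (L : Type) (op : L -> L -> L) (x : seq L) (y : L) : L :=
  foldl (fun z xi => op xi z) y x.

(* Both problems are relative to the fixed S_A = <s_1, ..., s_m>, so the s_i are
   not part of a query. The answer (a', a0') has k_A' = size a'. *)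
Record oracle (L : Type) (n : nat) : Type := Oracle {
  ask_modsimItLDP : L -> n.-tuple (L * L) -> seq L * L;
  ask_MSP : L -> {T : tree & (leaves T).-tuple L}
}.

(* An oracle is constrained only on inputs that satisfy the problem's promise. *)
Definition solves_modsimItLDP (L : Type) (op : L -> L -> L) (m n : nat)
    (s : m.-tuple L) (O : oracle L n) : Prop :=
  forall (p0 : L) (tt' : n.-tuple (L * L)),
    (exists (kA : nat) (a : kA.-tuple L) (a0 : L),
       [/\ 0 < kA, in_submagma op s a0,
           forall i : 'I_n, (tnth tt' i).2 = phi op a (tnth tt' i).1
         & p0 = phi op a a0]) ->
    let: (a', a0') := ask_modsimItLDP O p0 tt' in
    [/\ in_submagma op s a0', phi op a' a0' = p0
      & forall i : 'I_n, phi op a' (tnth tt' i).1 = (tnth tt' i).2].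

Definition solves_MSP (L : Type) (op : L -> L -> L) (m n : nat)
    (s : m.-tuple L) (O : oracle L n) : Prop :=
  forall c : L, in_submagma op s c ->
    presents op s c (projT2 (ask_MSP O c)).

(* Black-box attackers. An attacker is a program that does not depend on L or *;
   it holds elements of L in numbered registers and can only multiply two of
   them, compare two of them, query the oracle, and output one. Elements
   produced by an instruction are appended to the registers; the attacker itself
   sees only the discrete part of an answer: the outcome of a comparison, the
   length of a' and the tree T. Without this restriction "K can be found" would
   be no more than "K is a function of the public data". *)
Inductive attacker (n : nat) : Type :=
| Output of nat
| Mul of nat & nat & attacker n
| Compare of nat & nat & (bool -> attacker n)
| QueryLDP of nat & n.-tuple (nat * nat) & (nat -> attacker n)
| QueryMSP of nat & (tree -> attacker n).

(* Reading an unassigned register gives the default x0. *)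
Fixpoint run (L : Type) (op : L -> L -> L) (n : nat) (O : oracle L n) (x0 : L)
    (mem : seq L) (A : attacker n) {struct A} : L :=
  let reg := nth x0 mem in
  match A with
  | Output i => reg i
  | Mul i j A' => run op O x0 (rcons mem (op (reg i) (reg j))) A'
  | Compare i j k => run op O x0 mem (k `[< reg i = reg j >])
  | QueryLDP i q k =>
      let: (a', a0') :=
        ask_modsimItLDP O (reg i)
          [tuple of map (fun jj => (reg jj.1, reg jj.2)) q] in
      run op O x0 (mem ++ a0' :: a') (k (size a'))
  | QueryMSP i k =>
      let: existT T r := ask_MSP O (reg i) in
      run op O x0 (mem ++ r) (k T)
  end.

(* s_1..s_m, s'_1..s'_m, t_1..t_n, t'_1..t'_n, p_0 *)
Definition public_data (L : Type) (op : L -> L -> L) (m n : nat)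
    (s : m.-tuple L) (t : n.-tuple L) (a0 : L) (a b : seq L) : seq L :=
  s ++ map (phi op b) s ++ t ++ map (phi op a) t ++ [:: phi op a a0].

Definition shared_key (L : Type) (op : L -> L -> L) (a0 : L) (a b : seq L) : L :=
  phi op a (phi op b a0).

(* The default register value is the public element p_0. *)
Definition breaks_protocol1 (L : Type) (op : L -> L -> L) (m n : nat)
    (s : m.-tuple L) (t : n.-tuple L) (O : oracle L n) (A : attacker n) : Prop :=
  forall (kA kB : nat) (a0 : L) (a : kA.-tuple L) (b : kB.-tuple L),
    0 < kA -> 0 < kB ->
    in_submagma op s a0 ->
    (forall i : 'I_kB, in_submagma op t (tnth b i)) ->
    run op O (phi op a a0) (public_data op s t a0 a b) A
      = shared_key op a0 a b.

(* Main.v *)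
Require Import Defs.
From mathcomp Require Import all_boot.
From mathcomp Require Import boolp zify.

(** Every map [phi a] is an endomorphism of [L] by left distributivity. The
    attacker asks for [(a', a0')] with [phi a' t_i = t_i'] and
    [phi a' a0' = p0], so [phi a'] and [alpha] agree on [S_B], where all [b_i]
    live. Since
    [alpha (beta a0) = phi (map alpha b) p0 = phi (map (phi a') b) (phi a' a0')
     = phi a' (beta a0')],
    it remains to compute [beta a0']. A presentation of [a0'] as a tree over the
    [s_j] is obtained from the membership oracle, and [beta a0'] is the value of
    the same tree at the corresponding [s_j']. *)

Set Implicit Arguments.
Unset Strict Implicit.
Unset Printing Implicit Defensive.

Section Endomorphisms.

Variables (L : Type) (op : L -> L -> L).

Definition endomorphism (f : L -> L) : Prop := {morph f : x y / op x y}.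

Lemma phi_endomorphism (a : seq L) : LD_system op -> endomorphism (phi op a).
Proof.
by move=> ld; elim: a => [|c a IHa] x y //=; rewrite /phi /= ld; apply: IHa.
Qed.

Lemma endomorphism_phi (f : L -> L) (b : seq L) (x : L) :
  endomorphism f -> f (phi op b x) = phi op (map f b) (f x).
Proof.
move=> fM; elim: b x => [|c b IHb] x //=.
by rewrite /phi /= -fM; apply: IHb.
Qed.

Lemma endomorphism_tree_eval (f : L -> L) (T : tree)
    (y : 'I_(leaves T) -> L) :
  endomorphism f -> f (tree_eval op T y) = tree_eval op T (fun i => f (y i)).
Proof.
by move=> fM; elim: T y => [|T1 IH1 T2 IH2] y //=; rewrite fM IH1 IH2.
Qed.

Lemma eq_tree_eval (T : tree) (y z : 'I_(leaves T) -> L) :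
  y =1 z -> tree_eval op T y = tree_eval op T z.
Proof. by move=> /funext ->. Qed.

(** Endomorphisms commute with tree evaluation, so their values on the generators determine them on
    the whole submagma. *)
Lemma eq_on_submagma (f g : L -> L) (n : nat) (t : n.-tuple L) (c : L) :
  endomorphism f -> endomorphism g ->
  (forall i : 'I_n, f (tnth t i) = g (tnth t i)) ->
  in_submagma op t c -> f c = g c.
Proof.
move=> fM gM fg [T [r [rt ->]]].
rewrite !endomorphism_tree_eval //; apply: eq_tree_eval => i.
by have [j ->] := rt i.
Qed.

End Endomorphisms.

Section Attack.

Variables m n : nat.

(* Passes to [k] the register of [s_j'], where [s_j] is the content of register
   [p]; the final [k 0] is reached only if there is no such [j]. *)
Fixpoint lookup (p : nat) (js : seq nat) (k : nat -> attacker n) :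
    attacker n :=
  if js is j :: js' then
    Compare p j (fun e => if e then k (m + j) else lookup p js' k)
  else k 0.

(* The leaves of [T] are in the registers from [p] on, and [free] is the first
   unassigned register; [k] receives the register of the result and the new
   first unassigned register. *)
Fixpoint compute_tree (T : tree) (p free : nat)
    (k : nat -> nat -> attacker n) : attacker n :=
  match T with
  | Leaf => lookup p (iota 0 m) (fun q => k q free)
  | Node T1 T2 =>
      compute_tree T1 p free (fun q1 free1 =>
      compute_tree T2 (p + leaves T1) free1 (fun q2 free2 =>
      Mul q1 q2 (k free2 free2.+1)))
  end.

(** Each product lands in register [free], which then serves as the right operand of the next
    multiplication. *)
Fixpoint compute_phi (ps : seq nat) (q free : nat) : attacker n :=
  if ps is p :: ps' then Mul p q (compute_phi ps' free free.+1)
  else Output n q.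

(** The public data fill [N] registers, the last one holding p_0. The first answer puts a0' into
    register [N] and a' into the [l] registers from [N.+1] on; the leaves of [T] come right
    after. *)
Definition attack : attacker n :=
  let N := (m + m + n + n).+1 in
  QueryLDP N.-1 [tuple (m + m + i, m + m + n + i) | i < n] (fun l =>
  QueryMSP N (fun T =>
  compute_tree T (N + l.+1) (N + l.+1 + leaves T) (fun q free =>
  compute_phi (iota N.+1 l) q free))).

Variables (L : Type) (op : L -> L -> L) (O : oracle L n) (x0 : L).

Lemma nth_cat_lt (u v : seq L) (i : nat) :
  i < size u -> nth x0 (u ++ v) i = nth x0 u i.
Proof. by rewrite nth_cat => ->. Qed.

(** If entries repeat, the [j] found may differ from the intended one; this is harmless, since equal
    contents have equal images under [f]. *)
Lemma run_lookup (f : L -> L) (mem : seq L) (p : nat) (js : seq nat)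
    (k : nat -> attacker n) :
  (forall j, j \in js -> nth x0 mem (m + j) = f (nth x0 mem j)) ->
  (exists2 j, j \in js & nth x0 mem p = nth x0 mem j) ->
  exists2 j, j \in js &
    nth x0 mem (m + j) = f (nth x0 mem p) /\
    run op O x0 mem (lookup p js k) = run op O x0 mem (k (m + j)).
Proof.
elim: js => [|j js IHjs] memf [i]; first by [].
move=> ijs pi /=; case: asboolP => [pj|npj].
  by exists j; rewrite ?mem_head // pj memf ?mem_head.
have {}ijs : i \in js.
  by move: ijs; rewrite inE => /orP[/eqP ij|//]; rewrite ij in pi.
have [|i' i'js ?] := IHjs _ (ex_intro2 _ _ i ijs pi).
  by move=> j' j'js; rewrite memf // inE j'js orbT.
by exists i'; rewrite // inE i'js orbT.
Qed.

(** Registers are only appended, never overwritten, so the hypotheses on [mem] survive the left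
    subtree and are available for the right one. In the attack [f] is beta, of which only the values
    on the s_j are stored. *)
Lemma run_compute_tree (f : L -> L) (T : tree) (mem : seq L) (p : nat)
    (k : nat -> nat -> attacker n) :
  endomorphism op f ->
  m + m <= size mem -> p + leaves T <= size mem ->
  (forall j, j < m -> nth x0 mem (m + j) = f (nth x0 mem j)) ->
  (forall i, i < leaves T ->
     exists2 j, j < m & nth x0 mem (p + i) = nth x0 mem j) ->
  exists (ext : seq L) (q : nat),
    [/\ q < size (mem ++ ext),
        nth x0 (mem ++ ext) q =
          f (tree_eval op T (fun i => nth x0 mem (p + i)))
      & run op O x0 mem (compute_tree T p (size mem) k) =
          run op O x0 (mem ++ ext) (k q (size (mem ++ ext)))].
Proof.
move=> fM; elim: T mem p k => [|T1 IH1 T2 IH2] mem p k mm pT memf memp /=.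
  have [||j] := @run_lookup f mem p (iota 0 m) (fun q => k q (size mem)).
  - by move=> j; rewrite mem_iota => /memf.
  - have [j jm] := memp 0 isT; rewrite addn0 => pj.
    by exists j => //; rewrite mem_iota.
  rewrite mem_iota => /= jm [qf ->].
  by exists [::], (m + j); rewrite cats0 addn0; split => //; lia.
rewrite /= in pT memp.
have [||||e1 [q1 [q1s q1E ->]]] := IH1 mem p (fun q1 free1 =>
    compute_tree T2 (p + leaves T1) free1 (fun q2 free2 =>
    Mul q1 q2 (k free2 free2.+1))) => //.
- lia.
- by move=> i iT; apply: memp; lia.
have old i : i < size mem -> nth x0 (mem ++ e1) i = nth x0 mem i.
  exact: nth_cat_lt.
have [||||e2 [q2 [q2s q2E ->]]] := IH2 (mem ++ e1) (p + leaves T1)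
    (fun q2 free2 => Mul q1 q2 (k free2 free2.+1)).
- by rewrite size_cat; lia.
- by rewrite size_cat; lia.
- by move=> j jm; rewrite !old ?memf //; lia.
- move=> i iT; have [|j jm E] := memp (leaves T1 + i); first by lia.
  by exists j => //; rewrite !old -?addnA //; lia.
(* The left result sits in a register assigned before the right subtree is computed, so it is still
   intact. *)
have q1E' : nth x0 ((mem ++ e1) ++ e2) q1 =
    f (tree_eval op T1 (fun i => nth x0 mem (p + i))) by rewrite nth_cat_lt.
set z := op (nth x0 ((mem ++ e1) ++ e2) q1) (nth x0 ((mem ++ e1) ++ e2) q2).
have E : rcons ((mem ++ e1) ++ e2) z = mem ++ rcons (e1 ++ e2) z.
  by rewrite -!cats1 !catA.
exists (rcons (e1 ++ e2) z), (size ((mem ++ e1) ++ e2)).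
rewrite -E size_rcons; split=> //=.
rewrite nth_rcons ltnn eqxx /z q1E' q2E -fM; congr (f (op _ _)).
apply: eq_tree_eval => i /=; rewrite addnA old //.
by have := ltn_ord i; lia.
Qed.

Lemma run_compute_phi (ps : seq nat) (mem : seq L) (q : nat) :
  all (fun p => p < size mem) ps ->
  run op O x0 mem (compute_phi ps q (size mem)) =
    phi op (map (nth x0 mem) ps) (nth x0 mem q).
Proof.
elim: ps mem q => [|p ps IHps] mem q //= /andP[pmem psmem].
set z := op _ _.
(* The product [z] is stored at index [size mem], the very register passed on as next operand. *)
rewrite -(size_rcons mem z) IHps; last first.
  by apply: sub_all psmem => i; rewrite size_rcons; apply: ltnW.
rewrite nth_rcons ltnn eqxx {2}/phi /=; congr foldl.
by apply/eq_in_map => i /(allP psmem) imem; rewrite nth_rcons imem.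
Qed.

End Attack.

Lemma shared_keyE (L : Type) (op : L -> L -> L) (n kB : nat) (t : n.-tuple L)
    (b : kB.-tuple L) (a a' : seq L) (a0 a0' : L) :
  LD_system op ->
  (forall i : 'I_kB, in_submagma op t (tnth b i)) ->
  (forall i : 'I_n, phi op a' (tnth t i) = phi op a (tnth t i)) ->
  phi op a' a0' = phi op a a0 ->
  shared_key op a0 a b = phi op a' (phi op b a0').
Proof.
move=> ld bt a't a'0; have phiM c := phi_endomorphism c ld.
rewrite /shared_key (endomorphism_phi b a0 (phiM a)).
rewrite (endomorphism_phi b a0' (phiM a')) a'0.
congr (phi op _ _).
(* Viewed as tuples, the two sequences can be compared entry by entry, each b_i lying in S_B. *)
rewrite -[LHS]/(tval (map_tuple (phi op a) b)).
rewrite -[RHS]/(tval (map_tuple (phi op a') b)).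
congr tval; apply: eq_from_tnth => i; rewrite !tnth_map.
by symmetry; apply: eq_on_submagma (phiM a') (phiM a) a't (bt i).
Qed.

Theorem proposition3p4 (m n : nat) :
  exists A : attacker n,
    forall (L : Type) (op : L -> L -> L), LD_system op ->
    forall (s : m.-tuple L) (t : n.-tuple L) (O : oracle L n),
      solves_modsimItLDP op s O ->
      solves_MSP op s O ->
      breaks_protocol1 op s t O A.
Proof.
exists (attack m n) => L op ld s t O ldpO mspO kA kB a0 a b kA0 kB0 a0s bt.
set x0 := phi op a a0; set mem := public_data _ _ _ _ _ _.
have memE : mem = s ++ map (phi op b) s ++ t ++ map (phi op a) t ++ [:: x0].
  by [].
clearbody mem.
have memS : size mem = (m + m + n + n).+1.
  by rewrite memE !size_cat !size_map !size_tuple /=; lia.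
have mem_s j : j < m -> nth x0 mem j = nth x0 s j.
  by move=> jm; rewrite memE nth_cat size_tuple jm.
have mem_s' j : j < m -> nth x0 mem (m + j) = phi op b (nth x0 s j).
  move=> jm; rewrite memE nth_cat size_tuple ltnNge leq_addr /= addKn.
  by rewrite nth_cat size_map size_tuple jm (nth_map x0) ?size_tuple.
have mem_t (i : 'I_n) : nth x0 mem (m + m + i) = tnth t i.
  rewrite memE catA nth_cat size_cat size_map !size_tuple ltnNge leq_addr /=.
  by rewrite addKn nth_cat size_tuple ltn_ord -tnth_nth.
have mem_t' (i : 'I_n) : nth x0 mem (m + m + n + i) = phi op a (tnth t i).
  rewrite memE 2!catA nth_cat !size_cat size_map !size_tuple ltnNge leq_addr /=.
  rewrite addKn nth_cat size_map size_tuple ltn_ord (nth_map x0) ?size_tuple //.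
  by rewrite -tnth_nth.
have mem_p0 : nth x0 mem (m + m + n + n) = x0.
  rewrite memE 3!catA nth_cat !size_cat !size_map !size_tuple ltnn subnn //.
rewrite /attack /= mem_p0.
set q := [tuple of map _ _].
have qE i : tnth q i = (tnth t i, phi op a (tnth t i)).
  by rewrite tnth_map tnth_mktuple /= mem_t mem_t'.
have := ldpO x0 q; case: (ask_modsimItLDP O x0 q) => a' a0' /= ldp.
(* Alice's own secret key witnesses the promise of the query. *)
have [|a0's a'0 a't] := ldp.
  by exists kA, a, a0; split => // i; rewrite qE.
have {}a't i : phi op a' (tnth t i) = phi op a (tnth t i).
  by have := a't i; rewrite qE.
have reg_a0' : nth x0 (mem ++ a0' :: a') (m + m + n + n).+1 = a0'.
  by rewrite -memS nth_cat ltnn subnn.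
rewrite reg_a0'; have := mspO _ a0's.
case: (ask_MSP O a0') => T r /= [rs a0'E].
set mem2 := (_ ++ _) ++ _.
have mem2_lt i : i < size mem -> nth x0 mem2 i = nth x0 mem i.
  by move=> ilt; rewrite /mem2 -catA nth_cat ilt.
have mem2S : size mem2 = (m + m + n + n).+1 + (size a').+1 + leaves T.
  by rewrite /mem2 !size_cat memS size_tuple.
have mem2_r (i : 'I_(leaves T)) :
    nth x0 mem2 ((m + m + n + n).+1 + (size a').+1 + i) = tnth r i.
  rewrite /mem2 nth_cat size_cat memS /= ltnNge leq_addr /= addKn.
  by rewrite -tnth_nth.
rewrite -mem2S.
have [|||||ext [q' [_ q'E ->]]] := @run_compute_tree m n L op O x0 (phi op b) T
  mem2 ((m + m + n + n).+1 + (size a').+1)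
  (fun q0 => [eta compute_phi n (iota (m + m + n + n).+2 (size a')) q0]).
- exact: phi_endomorphism.
- by rewrite mem2S; lia.
- by rewrite mem2S.
- by move=> j jm; rewrite !mem2_lt ?memS ?mem_s' ?mem_s //; lia.
(* The presentation returned by the membership oracle makes every leaf some s_j, so each lookup
   succeeds. *)
- move=> i iT; have [j E] := rs (Ordinal iT).
  exists j => //; rewrite (mem2_r (Ordinal iT)) E mem2_lt ?mem_s //.
    by rewrite -tnth_nth.
  by rewrite memS; have := ltn_ord j; lia.
rewrite run_compute_phi; last first.
  apply/allP => i; rewrite mem_iota size_cat mem2S; lia.
rewrite (shared_keyE ld bt a't a'0) q'E; congr (phi op _ (phi op b _)); last first.
  by rewrite a0'E; apply: eq_tree_eval.
(* Register [size mem] is taken by a0', so the entries of a' are read from the next one on. *)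
apply: (@eq_from_nth _ x0); rewrite size_map size_iota // => i ia'.
rewrite (nth_map 0) ?size_iota // nth_iota // nth_cat_lt; last first.
  by rewrite mem2S; lia.
rewrite /mem2 nth_cat_lt; last by rewrite size_cat memS /=; lia.
by rewrite -memS addSnnS nth_cat ltnNge leq_addr /= addKn.
Qed.
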